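(* Let $n\ge2$ and let $\mu_1,\dots,\mu_n\in\mathbb C$ be pairwise distinct. The boundary classical $r$-matrix $b_{CG}\in\mathfrak{sl}(n)\wedge\mathfrak{sl}(n)$, $$b_{CG}=\sum_{i=1}^{n}\sum_{j=1}^{n-1}\Bigl(1-\frac jn\Bigr)e^i_i\wedge e^{j+1}_j+\sum_{i,j:\,i<j}\ \sum_{k=1}^{j-i}e^{i+k}_i\wedge e^{j-k+1}_j ,$$ transforms into the solution $\tilde r\in\mathfrak{sl}(n)\wedge\mathfrak{sl}(n)$ of the classical Yang--Baxter equation, $$\tilde r=\sum_{i,j:\,i<j}\frac{\tilde Z^i_j\wedge\tilde Z^j_i}{\mu_i-\mu_j},\qquad \tilde Z^i_j=e^i_j-e^j_j+\frac1n\sum_{k=1}^ne^k_k ,$$ by a change of basis with the matrix $X_\mu\in GL(n)$, $(X_\mu)^j_k=e_{k-1}(\mu_1,\dots,\hat\mu_j,\dots,\mu_n)$: $$\tilde r=(\mathrm{Ad}_{X_\mu}\otimes\mathrm{Ad}_{X_\mu})(b_{CG}).$$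
   Context: $\mathbb C^n$ has basis $e_1,\dots,e_n$; $e^i_j$ is the matrix unit $e^i_j(e_k)=\delta^i_ke_j$; entries of an operator $A$ are given by $A(e_k)=\sum_jA^j_ke_j$ (upper index is the row); $x\wedge y=x\otimes y-y\otimes x$; $\mathrm{Ad}_X(A)=XAX^{-1}$. In the formula for $X_\mu$, $e_m(\cdot)$ is the $m$-th elementary symmetric polynomial ($e_0=1$) and the hat means that $\mu_j$ is omitted. The classical Yang--Baxter equation is $[r_{12},r_{13}]+[r_{12},r_{23}]+[r_{13},r_{23}]=0$. *)

(* Defs.v *)
From mathcomp Require Import all_boot all_order all_algebra.
From mathcomp Require Export mxtens complex reals.
From mathcomp Require mpoly.

Set Implicit Arguments.
Unset Strict Implicit.
Unset Printing Implicit Defensive.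
Import GRing.Theory.
Local Open Scope ring_scope.

(* Tensors in gl(n) (x) gl(n) are elements of
   'M_(n * n) = End(C^n (x) C^n), with pure tensors given by the Kronecker
   product A *t B; likewise gl(n)^(x)3 is 'M_(n * (n * n)). All indices are
   0-based. *)

Section Tensors.
Variables (F : fieldType) (n : nat).
Implicit Types (A B X : 'M[F]_n) (t r : 'M[F]_(n * n)).

Definition wedge A B : 'M[F]_(n * n) := A *t B - B *t A.

Definition sl_wedge_sl t : Prop :=
  exists s : seq ('M[F]_n * 'M[F]_n),
    all (fun p => (\tr p.1 == 0) && (\tr p.2 == 0)) s
    /\ t = \sum_(p <- s) wedge p.1 p.2.

(* For bilinear f, the unique linear map sending each A *t B to f A B
   (see tens_liftE). *)
Definition tens_lift (V : lmodType F) (f : 'M[F]_n -> 'M[F]_n -> V) t : V :=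
  \sum_(i < n) \sum_(j < n) \sum_(k < n) \sum_(l < n)
    t (mxtens_index (i, k)) (mxtens_index (j, l))
      *: f (delta_mx i j) (delta_mx k l).

Definition tens_map (f g : 'M[F]_n -> 'M[F]_n) t : 'M[F]_(n * n) :=
  tens_lift (fun A B => f A *t g B) t.

Definition Ad X A : 'M[F]_n := X *m A *m invmx X.

Definition leg12 r : 'M[F]_(n * (n * n)) :=
  tens_lift (fun A B => A *t (B *t 1%:M)) r.
Definition leg13 r : 'M[F]_(n * (n * n)) :=
  tens_lift (fun A B => A *t (1%:M *t B)) r.
Definition leg23 r : 'M[F]_(n * (n * n)) :=
  tens_lift (fun A B => 1%:M *t (A *t B)) r.

Definition lie_br (m : nat) (A B : 'M[F]_m) : 'M[F]_m := A *m B - B *m A.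

Definition CYBE r : Prop :=
  lie_br (leg12 r) (leg13 r) + lie_br (leg12 r) (leg23 r)
    + lie_br (leg13 r) (leg23 r) = 0.

Lemma tens_liftE (V : lmodType F) (f : 'M[F]_n -> 'M[F]_n -> V) A B :
  (forall a C D E, f (a *: C + D) E = a *: f C E + f D E) ->
  (forall a C D E, f E (a *: C + D) = a *: f E C + f E D) ->
  tens_lift f (A *t B) = f A B.
Proof.
move=> fl fr.
have f0l E : f 0 E = 0.
  by have := fl (-1) 0 0 E; rewrite scaler0 addr0 scaleN1r addNr.
have f0r E : f E 0 = 0.
  by have := fr (-1) 0 0 E; rewrite scaler0 addr0 scaleN1r addNr.
have fDl C D E : f (C + D) E = f C E + f D E.
  by have := fl 1 C D E; rewrite !scale1r.
have fDr C D E : f E (C + D) = f E C + f E D.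
  by have := fr 1 C D E; rewrite !scale1r.
have fZl a C E : f (a *: C) E = a *: f C E.
  by have := fl a C 0 E; rewrite !addr0 f0l addr0.
have fZr a C E : f E (a *: C) = a *: f E C.
  by have := fr a C 0 E; rewrite !addr0 f0r addr0.
have fsl I (s : seq I) (G : I -> 'M_n) E :
    f (\sum_(i <- s) G i) E = \sum_(i <- s) f (G i) E.
  exact: (big_morph (f^~ E) (fun C D => fDl C D E) (f0l E)).
have fsr I (s : seq I) (G : I -> 'M_n) E :
    f E (\sum_(i <- s) G i) = \sum_(i <- s) f E (G i).
  exact: (big_morph (f E) (fun C D => fDr C D E) (f0r E)).
rewrite {2}[A]matrix_sum_delta fsl; apply: eq_bigr => i _.
rewrite fsl; apply: eq_bigr => j _.
rewrite {2}[B]matrix_sum_delta fsr; apply: eq_bigr => k _.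
rewrite fsr; apply: eq_bigr => l _.
by rewrite tensmxE fZl fZr scalerA.
Qed.

End Tensors.

Section RMatrices.
Variables (F : fieldType) (n : nat).

(* e^i_j, sending the i-th basis vector to the j-th: row j, column i. The
   indices are naturals so that shifts such as j - k + 1 can be written; the
   matrix is 0 when an index is out of range, which does not occur below. *)
Definition e_ (i j : nat) : 'M[F]_n :=
  \matrix_(a < n, b < n) ((a == j :> nat) && (b == i :> nat))%:R.

(* In the first sum, the coefficient for the 0-based index j is
   1 - (j + 1) / n. *)
Definition b_CG : 'M[F]_(n * n) :=
  \sum_(0 <= i < n) \sum_(0 <= j < n.-1)
     (1 - j.+1%:R / n%:R) *: wedge (e_ i i) (e_ j.+1 j)
  + \sum_(0 <= i < n) \sum_(i.+1 <= j < n) \sum_(1 <= k < (j - i).+1)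
     wedge (e_ (i + k) i) (e_ (j - k + 1) j).

Definition Ztilde (i j : nat) : 'M[F]_n :=
  e_ i j - e_ j j + n%:R^-1 *: \sum_(0 <= k < n) e_ k k.

Variable mu : 'I_n -> F.

Definition r_tilde : 'M[F]_(n * n) :=
  \sum_(i < n) \sum_(j < n | (i < j)%N)
     (mu i - mu j)^-1 *: wedge (Ztilde i j) (Ztilde j i).

(* lift j enumerates the indices different from j. With k 0-based, the degree
   k - 1 of the elementary symmetric polynomial becomes k. *)
Definition X_mu : 'M[F]_n :=
  \matrix_(j < n, k < n)
     mpoly.meval (fun i : 'I_n.-1 => mu (lift j i)) (mpoly.mesym n.-1 F k).

End RMatrices.

Arguments e_ {F n} i j.
Arguments b_CG F n : clear implicits.
Arguments Ztilde {F n} i j.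

(* Main.v *)
Require Import Defs.
From mathcomp Require Import all_boot all_order all_algebra.
From mathcomp Require Import mxtens complex reals.
From mathcomp Require Import ring zify.
From mathcomp Require mpoly.

(** A row vector [a] is the same thing as the polynomial
    [\sum_k a_k x^(n-1-k)] of degree less than [n], and then tensors in
    [gl(n) (x) gl(n)] act on polynomials [G (x, y)]. In this picture [b_CG] is
    the operator
      [G |-> (G (x, y) - G (y, x)) / (x - y) + (d/dy - d/dx) G / n],
    by summing geometric progressions ([T_CG_moment], [b_CGE]). Concretely,
    the action is read off from the products with [moment x *t moment y],
    where the columns of [moment x] list the powers of [x], and such products
    for [x <> y] determine a matrix ([moment2_eq0]).

    The rows of [X_mu] are the coefficients of the polynomials
    [\prod_(i <> j) (x + mu_i)], a Lagrange basis for the nodes [- mu_j]. So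
    [X_mu] is invertible ([X_mu_unit]), and it remains to see that [r_tilde]
    is the same operator, written in this basis. In the quadratic part this is
    the identity
    [lagr i - lagr j = (mu j - mu i) lagr2 i j]; the terms with [1/n] add up
    to the derivative of a product ([r_tilde_moment]).

    For the Yang-Baxter equation, divided differences satisfy it by a
    computation with rational functions in three variables ([CYBE_T_CG]). They
    also commute with [d/dx + d/dy], by translation invariance, and this lets
    one add a multiple of [d/dy - d/dx] ([CYBE_add_wedge1]). Conjugation by
    [X_mu] transports the equation to [r_tilde] ([CYBE_Ad]).

    Finally, [b_CG] is a sum of wedges of traceless matrices because the
    derivative term is exactly what the projection of the divided difference
    to [sl(n)] adds ([b_CG_sl]). *)

Set Implicit Arguments.
Unset Strict Implicit.
Unset Printing Implicit Defensive.
Import Order.TTheory GRing.Theory Num.Theory.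
Local Open Scope ring_scope.

(** * Kronecker products, wedges and the three legs *)

Section TensorAlgebra.
Variable F : fieldType.

Lemma tensmxDl m n p q (A B : 'M[F]_(m, n)) (C : 'M[F]_(p, q)) :
  (A + B) *t C = A *t C + B *t C.
Proof.
apply/matrixP => i j; case: (mxtens_indexP i) => i1 i2.
by case: (mxtens_indexP j) => j1 j2; rewrite [RHS]mxE !tensmxE !mxE mulrDl.
Qed.

Lemma tensmxDr m n p q (A : 'M[F]_(m, n)) (B C : 'M[F]_(p, q)) :
  A *t (B + C) = A *t B + A *t C.
Proof.
apply/matrixP => i j; case: (mxtens_indexP i) => i1 i2.
by case: (mxtens_indexP j) => j1 j2; rewrite [RHS]mxE !tensmxE !mxE mulrDr.
Qed.

Lemma tensmxZl m n p q a (A : 'M[F]_(m, n)) (B : 'M[F]_(p, q)) :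
  (a *: A) *t B = a *: (A *t B).
Proof.
apply/matrixP => i j; case: (mxtens_indexP i) => i1 i2.
by case: (mxtens_indexP j) => j1 j2; rewrite [RHS]mxE !tensmxE !mxE mulrA.
Qed.

Lemma tensmxZr m n p q a (A : 'M[F]_(m, n)) (B : 'M[F]_(p, q)) :
  A *t (a *: B) = a *: (A *t B).
Proof.
apply/matrixP => i j; case: (mxtens_indexP i) => i1 i2.
by case: (mxtens_indexP j) => j1 j2; rewrite [RHS]mxE !tensmxE !mxE mulrCA.
Qed.

Lemma tensmx_suml m n p q I (s : seq I) (P : pred I)
    (A : I -> 'M[F]_(m, n)) (B : 'M[F]_(p, q)) :
  (\sum_(i <- s | P i) A i) *t B = \sum_(i <- s | P i) A i *t B.
Proof.
by apply: (big_morph (fun A => A *t B)) => [C D|];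
  rewrite ?tensmxDl ?tens0mx.
Qed.

Lemma tensmx_sumr m n p q I (s : seq I) (P : pred I)
    (A : 'M[F]_(m, n)) (B : I -> 'M[F]_(p, q)) :
  A *t (\sum_(i <- s | P i) B i) = \sum_(i <- s | P i) A *t B i.
Proof.
by apply: (big_morph (fun B => A *t B)) => [C D|];
  rewrite ?tensmxDr ?tensmx0.
Qed.

Lemma tensmx11 m n : (1%:M : 'M[F]_m) *t (1%:M : 'M[F]_n) = 1%:M.
Proof.
apply/matrixP => i j; case: (mxtens_indexP i) => i1 i2.
case: (mxtens_indexP j) => j1 j2; rewrite tensmxE !mxE -natrM mulnb.
by rewrite (inj_eq (can_inj (@mxtens_indexK _ _))).
Qed.

Variable n : nat.
Implicit Types (A B C D X : 'M[F]_n) (s t : 'M[F]_(n * n)).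

Lemma wedgeDr A B C : wedge A (B + C) = wedge A B + wedge A C.
Proof. by rewrite /wedge tensmxDl tensmxDr addrACA opprD. Qed.

Lemma wedgeZl a A B : wedge (a *: A) B = a *: wedge A B.
Proof. by rewrite /wedge tensmxZl tensmxZr scalerBr. Qed.

Lemma wedgeZr a A B : wedge A (a *: B) = a *: wedge A B.
Proof. by rewrite /wedge tensmxZl tensmxZr scalerBr. Qed.

Lemma wedgeNC A B : wedge A B = - wedge B A.
Proof. by rewrite /wedge opprB. Qed.

Lemma wedge_suml I (r : seq I) (P : pred I) (f : I -> 'M[F]_n) B :
  wedge (\sum_(i <- r | P i) f i) B = \sum_(i <- r | P i) wedge (f i) B.
Proof. by rewrite /wedge tensmx_suml tensmx_sumr sumrB. Qed.

Lemma wedge_sumr I (r : seq I) (P : pred I) A (f : I -> 'M[F]_n) :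
  wedge A (\sum_(i <- r | P i) f i) = \sum_(i <- r | P i) wedge A (f i).
Proof. by rewrite /wedge tensmx_suml tensmx_sumr sumrB. Qed.

Lemma mul_wedge A B C D :
  wedge A B *m (C *t D) = (A *m C) *t (B *m D) - (B *m C) *t (A *m D).
Proof. by rewrite /wedge mulmxBl !tensmx_mul. Qed.

(** Matrix units of [F^n (x) F^n] are pure tensors, so a statement that is
    linear in a tensor need only be checked on pure ones. *)
Lemma tens_ind (P : 'M[F]_(n * n) -> Prop) :
  P 0 -> (forall s t, P s -> P t -> P (s + t)) ->
  (forall a t, P t -> P (a *: t)) -> (forall A B, P (A *t B)) ->
  forall t, P t.
Proof.
move=> P0 PD PZ PT t; rewrite [t]matrix_sum_delta.
apply: big_ind => // i _; apply: big_ind => // j _; apply: PZ.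
case: (mxtens_indexP i) => i1 i2; case: (mxtens_indexP j) => j1 j2.
suff -> : delta_mx (mxtens_index (i1, i2)) (mxtens_index (j1, j2)) =
  delta_mx i1 j1 *t delta_mx i2 j2 :> 'M[F]_(n * n) by [].
apply/matrixP => k l; case: (mxtens_indexP k) => k1 k2.
case: (mxtens_indexP l) => l1 l2; rewrite tensmxE !mxE -natrM mulnb.
by rewrite !(inj_eq (can_inj (@mxtens_indexK _ _))) !xpair_eqE andbACA.
Qed.

Section Lift.
Variables (V : lmodType F) (f : 'M[F]_n -> 'M[F]_n -> V).

Lemma tens_lift0 : tens_lift f 0 = 0.
Proof.
rewrite /tens_lift.
by do 4! [rewrite big1 // => ? _]; rewrite mxE scale0r.
Qed.

Lemma tens_liftD s t : tens_lift f (s + t) = tens_lift f s + tens_lift f t.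
Proof.
rewrite /tens_lift.
by do 4! [rewrite -big_split; apply: eq_bigr => ? _ /=]; rewrite mxE scalerDl.
Qed.

Lemma tens_liftZ a t : tens_lift f (a *: t) = a *: tens_lift f t.
Proof.
rewrite /tens_lift.
by do 4! [rewrite scaler_sumr; apply: eq_bigr => ? _ /=]; rewrite mxE scalerA.
Qed.

End Lift.

Lemma leg12_tens A B : leg12 (A *t B) = A *t (B *t 1%:M).
Proof.
by apply: tens_liftE => a C D E;
  rewrite ?(tensmxDl, tensmxDr, tensmxZl, tensmxZr).
Qed.

Lemma leg13_tens A B : leg13 (A *t B) = A *t (1%:M *t B).
Proof.
by apply: tens_liftE => a C D E;
  rewrite ?(tensmxDl, tensmxDr, tensmxZl, tensmxZr).
Qed.

Lemma leg23_tens A B : leg23 (A *t B) = 1%:M *t (A *t B).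
Proof.
by apply: tens_liftE => a C D E;
  rewrite ?(tensmxDl, tensmxDr, tensmxZl, tensmxZr).
Qed.

(** Both sides are bilinear in [s] and [t], so the pure tensors decide. The
    three legs are treated alike here and below: each is [tens_lift f] for its
    own [f]. *)
Lemma tens_lift_mul m (f : 'M[F]_n -> 'M[F]_n -> 'M[F]_m)
    (phi := tens_lift f) :
  (forall A B C D, phi (A *t B) *m phi (C *t D) = phi ((A *m C) *t (B *m D))) ->
  forall s t, phi (s *m t) = phi s *m phi t.
Proof.
move=> phiM s t; rewrite /phi.
elim/tens_ind: s => [|s s' IHs IHs'|a s IHs|A B].
- by rewrite mul0mx tens_lift0 mul0mx.
- by rewrite mulmxDl !tens_liftD IHs IHs' mulmxDl.
- by rewrite -scalemxAl !tens_liftZ IHs scalemxAl.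
elim/tens_ind: t => [|t t' IHt IHt'|a t IHt|C D].
- by rewrite mulmx0 tens_lift0 mulmx0.
- by rewrite mulmxDr !tens_liftD IHt IHt' mulmxDr.
- by rewrite -scalemxAr !tens_liftZ IHt scalemxAr.
by rewrite tensmx_mul; exact/esym/phiM.
Qed.

Lemma leg12M s t : leg12 (s *m t) = leg12 s *m leg12 t.
Proof.
by apply: tens_lift_mul => A B C D;
  rewrite -!/(leg12 _) !leg12_tens !tensmx_mul mulmx1.
Qed.

Lemma leg13M s t : leg13 (s *m t) = leg13 s *m leg13 t.
Proof.
by apply: tens_lift_mul => A B C D;
  rewrite -!/(leg13 _) !leg13_tens !tensmx_mul mulmx1.
Qed.

Lemma leg23M s t : leg23 (s *m t) = leg23 s *m leg23 t.
Proof.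
by apply: tens_lift_mul => A B C D;
  rewrite -!/(leg23 _) !leg23_tens !tensmx_mul mulmx1.
Qed.

Lemma tens_lift_comm m (f : 'M[F]_n -> 'M[F]_n -> 'M[F]_m) (M : 'M[F]_m)
    (phi := tens_lift f) :
  (forall A B, phi (A *t B) *m M = M *m phi (A *t B)) ->
  forall t, phi t *m M = M *m phi t.
Proof.
move=> phiC t; rewrite /phi.
elim/tens_ind: t => [|s t IHs IHt|a t IHt|A B]; last exact: phiC.
- by rewrite tens_lift0 mulmx0 mul0mx.
- by rewrite tens_liftD mulmxDl mulmxDr IHs IHt.
- by rewrite tens_liftZ -scalemxAl -scalemxAr IHt.
Qed.

Lemma leg12_comm t C (C3 := 1%:M *t (1%:M *t C) : 'M_(n * (n * n))) :
  leg12 t *m C3 = C3 *m leg12 t.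
Proof.
by apply: tens_lift_comm => A B;
  rewrite -/(leg12 _) leg12_tens !tensmx_mul !mulmx1 !mul1mx.
Qed.

Lemma leg13_comm t C (C2 := 1%:M *t (C *t 1%:M) : 'M_(n * (n * n))) :
  leg13 t *m C2 = C2 *m leg13 t.
Proof.
by apply: tens_lift_comm => A B;
  rewrite -/(leg13 _) leg13_tens !tensmx_mul !mulmx1 !mul1mx.
Qed.

Lemma leg23_comm t C (C1 := C *t (1%:M *t 1%:M) : 'M_(n * (n * n))) :
  leg23 t *m C1 = C1 *m leg23 t.
Proof.
by apply: tens_lift_comm => A B;
  rewrite -/(leg23 _) leg23_tens !tensmx_mul !mulmx1 !mul1mx.
Qed.

Lemma tens_map_Ad X t :
  tens_map (Ad X) (Ad X) t = (X *t X) *m t *m (invmx X *t invmx X).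
Proof.
elim/tens_ind: t => [|s t IHs IHt|a t IHt|A B].
- by rewrite /tens_map tens_lift0 mulmx0 mul0mx.
- by rewrite /tens_map tens_liftD -!/(tens_map _ _ _) IHs IHt mulmxDr mulmxDl.
- by rewrite /tens_map tens_liftZ -!/(tens_map _ _ _) IHt -scalemxAr -scalemxAl.
rewrite !tensmx_mul; apply: tens_liftE => a C D E;
 by rewrite /Ad !(mulmxDr, mulmxDl) -?scalemxAr -?scalemxAl
   !(tensmxDl, tensmxDr) !(tensmxZl, tensmxZr).
Qed.

Lemma conj_lie_br m (P Q A B : 'M[F]_m) : Q *m P = 1%:M ->
  lie_br (P *m A *m Q) (P *m B *m Q) = P *m lie_br A B *m Q.
Proof.
move=> QP.
have E (C D : 'M_m) : P *m C *m Q *m (P *m D *m Q) = P *m (C *m D) *m Q.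
  by rewrite !mulmxA -(mulmxA (P *m C)) QP mulmx1.
by rewrite /lie_br !E mulmxBr mulmxBl.
Qed.

Lemma tens_lift_conj m (f : 'M[F]_n -> 'M[F]_n -> 'M[F]_m) X Y (P Q : 'M[F]_m)
    (phi := tens_lift f) :
  (forall A B, phi ((X *m A *m Y) *t (X *m B *m Y)) = P *m phi (A *t B) *m Q) ->
  forall t, phi ((X *t X) *m t *m (Y *t Y)) = P *m phi t *m Q.
Proof.
move=> phiXY t; rewrite /phi.
elim/tens_ind: t => [|s t IHs IHt|a t IHt|A B].
- by rewrite mulmx0 mul0mx !tens_lift0 mulmx0 mul0mx.
- by rewrite mulmxDr mulmxDl !tens_liftD mulmxDr mulmxDl IHs IHt.
- by rewrite -scalemxAr -scalemxAl !tens_liftZ -scalemxAr -scalemxAl IHt.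
by rewrite !tensmx_mul; exact: phiXY.
Qed.

(** [Ad X (x) Ad X] is conjugation by [X (x) X], and every leg turns it into
    conjugation by [X (x) X (x) X], which preserves brackets. *)
Lemma CYBE_Ad X t : X \in unitmx -> CYBE t ->
  CYBE (tens_map (Ad X) (Ad X) t).
Proof.
move=> uX cybe; rewrite tens_map_Ad; set Y := invmx X.
pose P := X *t (X *t X); pose Q := Y *t (Y *t Y).
have XY : X *m 1%:M *m Y = 1%:M by rewrite mulmx1 mulmxV.
have QP : Q *m P = 1%:M by rewrite !tensmx_mul mulVmx // !tensmx11.
have L12 : leg12 (X *t X *m t *m (Y *t Y)) = P *m leg12 t *m Q.
  apply: tens_lift_conj => A B.
  by rewrite -!/(leg12 _) !leg12_tens !tensmx_mul XY.
have L13 : leg13 (X *t X *m t *m (Y *t Y)) = P *m leg13 t *m Q.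
  apply: tens_lift_conj => A B.
  by rewrite -!/(leg13 _) !leg13_tens !tensmx_mul XY.
have L23 : leg23 (X *t X *m t *m (Y *t Y)) = P *m leg23 t *m Q.
  apply: tens_lift_conj => A B.
  by rewrite -!/(leg23 _) !leg23_tens !tensmx_mul XY.
rewrite /CYBE L12 L13 L23 !conj_lie_br // -!mulmxDl -!mulmxDr.
by rewrite cybe mulmx0 mul0mx.
Qed.

Section LieBracket.
Variable m : nat.
Implicit Types U V W : 'M[F]_m.

Lemma lie_brC U V : lie_br U V = - lie_br V U.
Proof. by rewrite /lie_br opprB. Qed.

Lemma lie_brDr U V W : lie_br U (V + W) = lie_br U V + lie_br U W.
Proof. by rewrite /lie_br mulmxDr mulmxDl opprD addrACA. Qed.

Lemma lie_brBr U V W : lie_br U (V - W) = lie_br U V - lie_br U W.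
Proof.
by rewrite lie_brDr; congr (_ + _); rewrite /lie_br mulmxN mulNmx opprD.
Qed.

Lemma lie_brZr c U V : lie_br U (c *: V) = c *: lie_br U V.
Proof. by rewrite /lie_br -scalemxAl -scalemxAr scalerBr. Qed.

Lemma lie_br_comm U V : U *m V = V *m U -> lie_br U V = 0.
Proof. by rewrite /lie_br => ->; rewrite subrr. Qed.

(** The terms quadratic in [c] vanish because the [Ni] commute. The terms
    linear in [c] cancel: the bracket of [tij] with [Ni] is minus that with
    [Nj], and the bracket with the third operator is zero. *)
Lemma CYBE_add_commuting (c : F) (t12 t13 t23 N1 N2 N3 : 'M[F]_m) :
    lie_br t12 t13 + lie_br t12 t23 + lie_br t13 t23 = 0 ->
    lie_br t12 (N1 + N2) = 0 -> lie_br t13 (N1 + N3) = 0 ->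
    lie_br t23 (N2 + N3) = 0 ->
    lie_br t12 N3 = 0 -> lie_br t13 N2 = 0 -> lie_br t23 N1 = 0 ->
    lie_br N1 N2 = 0 -> lie_br N1 N3 = 0 -> lie_br N2 N3 = 0 ->
  let r12 := t12 + c *: (N2 - N1) in
  let r13 := t13 + c *: (N3 - N1) in
  let r23 := t23 + c *: (N3 - N2) in
  lie_br r12 r13 + lie_br r12 r23 + lie_br r13 r23 = 0.
Proof.
move=> cybe; rewrite !lie_brDr => /eqP; rewrite addrC addr_eq0 => /eqP s12.
move/eqP; rewrite addrC addr_eq0 => /eqP s13.
move/eqP; rewrite addrC addr_eq0 => /eqP s23.
move=> c12 c13 c23 n12 n13 n23 /=.
have z U : lie_br U U = 0 by apply: lie_br_comm.
have E (t u D E : 'M[F]_m) : lie_br D E = 0 ->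
    lie_br (t + c *: D) (u + c *: E) =
    lie_br t u + c *: (lie_br t E - lie_br u D).
  move=> DE; rewrite lie_brDr lie_brZr (lie_brC _ u) (lie_brC _ E).
  rewrite !lie_brDr !lie_brZr (lie_brC E D) (lie_brC u t) (lie_brC E t) DE.
  by rewrite oppr0 scaler0 addr0 opprD !opprK (scalerBr _ (lie_br t E)) addrAC
    addrA.
have D U V W (X : 'M_m) : lie_br (U - V) (W - X) =
    lie_br U W - lie_br U X - (lie_br V W - lie_br V X).
  rewrite lie_brBr (lie_brC _ W) (lie_brC _ X) !lie_brBr.
  rewrite (lie_brC W) (lie_brC W V) (lie_brC X U) (lie_brC X V).
  by apply/matrixP => i j; rewrite !mxE; ring.
have [n21 n32] : lie_br N2 N1 = 0 /\ lie_br N3 N2 = 0.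
  by rewrite lie_brC n12 oppr0 lie_brC n23 oppr0.
rewrite !E ?D ?n12 ?n13 ?n23 ?n21 ?n32 ?z ?subr0 //.
rewrite !lie_brBr c12 c13 c23 s12 s13 s23 -[RHS]cybe.
by apply/matrixP => i j; rewrite !mxE; ring.
Qed.

End LieBracket.

(** A solution that is invariant under [N] may be shifted by a multiple of
    [1 /\ N]. This trades a solution with values in [gl(n)] for one with values
    in [sl(n)]. *)
Lemma CYBE_add_wedge1 (c : F) N t :
  CYBE t -> lie_br t (N *t 1%:M + 1%:M *t N) = 0 ->
  CYBE (t + c *: wedge 1%:M N).
Proof.
move=> cybe comm.
pose N1 : 'M_(n * (n * n)) := N *t (1%:M *t 1%:M).
pose N2 : 'M_(n * (n * n)) := 1%:M *t (N *t 1%:M).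
pose N3 : 'M_(n * (n * n)) := 1%:M *t (1%:M *t N).
have [E12 E13 E23] :
    [/\ leg12 (t + c *: wedge 1%:M N) = leg12 t + c *: (N2 - N1),
    leg13 (t + c *: wedge 1%:M N) = leg13 t + c *: (N3 - N1)
  & leg23 (t + c *: wedge 1%:M N) = leg23 t + c *: (N3 - N2)].
  rewrite /wedge -(scaleN1r (N *t _)).
  rewrite /leg12 /leg13 /leg23 !(tens_liftD, tens_liftZ).
  rewrite -!/(leg12 _) -!/(leg13 _) -!/(leg23 _).
  by rewrite !leg12_tens !leg13_tens !leg23_tens !scaleN1r.
have leg_br (f : 'M[F]_n -> 'M[F]_n -> 'M[F]_(n * (n * n))) :
    (forall s u, tens_lift f (s *m u) = tens_lift f s *m tens_lift f u) ->
  lie_br (tens_lift f t)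
    (tens_lift f (N *t 1%:M) + tens_lift f (1%:M *t N)) = 0.
  move=> fM; rewrite -tens_liftD /lie_br -!fM; move/eqP: comm.
  by rewrite subr_eq0 => /eqP ->; rewrite subrr.
rewrite /CYBE E12 E13 E23; apply: CYBE_add_commuting => //.
- by have := leg_br _ leg12M; rewrite -!/(leg12 _) !leg12_tens.
- by have := leg_br _ leg13M; rewrite -!/(leg13 _) !leg13_tens.
- by have := leg_br _ leg23M; rewrite -!/(leg23 _) !leg23_tens.
- exact/lie_br_comm/leg12_comm.
- exact/lie_br_comm/leg13_comm.
- exact/lie_br_comm/leg23_comm.
all: by apply: lie_br_comm; rewrite !tensmx_mul !mulmx1 !mul1mx.
Qed.

End TensorAlgebra.

(** * Tensors evaluated on the moment curve *)

Section Columns.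
Variables (F : numFieldType) (n : nat).
Implicit Types (f g : 'I_n -> F) (x y z : F).

(** Column vectors are carried by square matrices with equal columns, so that
    the legs, which act on square factors only, apply to them unchanged. *)
Definition rep_col f : 'M[F]_n := \matrix_(i, j) f i.

Definition basis_col (i : 'I_n) : 'M[F]_n := rep_col (fun j => (j == i)%:R).

Lemma rep_col_sum f : rep_col f = \sum_i f i *: basis_col i.
Proof.
apply/matrixP => i j; rewrite !mxE summxE (bigD1 i) //= big1 => [|k ki].
  by rewrite !mxE eqxx mulr1 addr0.
by rewrite !mxE eq_sym (negPf ki) mulr0.
Qed.

Lemma mul_e_rep_col (p q : 'I_n) f : e_ p q *m rep_col f = f p *: basis_col q.
Proof.
apply/matrixP => i j; rewrite !mxE (bigD1 p) //= big1 => [|k kp].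
  by rewrite !mxE eqxx andbT addr0 mulrC.
by rewrite !mxE (negPf (kp : k != p :> nat)) andbF mul0r.
Qed.

Lemma rep_col_tens f g : rep_col f *t rep_col g =
  \sum_i \sum_j (f i * g j) *: (basis_col i *t basis_col j).
Proof.
rewrite !rep_col_sum tensmx_suml; apply: eq_bigr => i _.
by rewrite tensmx_sumr; apply: eq_bigr => j _;
  rewrite tensmxZl tensmxZr scalerA.
Qed.

(** The diagonal terms cancel, and the terms [(i, j)] and [(j, i)] have opposite
    coefficients. *)
Lemma rep_col_wedge f g :
  rep_col f *t rep_col g - rep_col g *t rep_col f =
  \sum_(i < n) \sum_(j < n | (i < j)%N)
     (f i * g j - f j * g i) *: wedge (basis_col i) (basis_col j).
Proof.
rewrite !rep_col_tens -sumrB; under eq_bigr => i _.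
  rewrite -sumrB; under eq_bigr => j _.
    rewrite -scalerBl (mulrC (g i)); over.
  rewrite (bigID (fun j : 'I_n => (i < j)%N)) /=.
  over.
rewrite big_split /= addrC.
have -> : \sum_(i < n) \sum_(j < n | ~~ (i < j)%N)
     (f i * g j - f j * g i) *: (basis_col i *t basis_col j) =
   - \sum_(i < n) \sum_(j < n | (i < j)%N)
       (f i * g j - f j * g i) *: (basis_col j *t basis_col i).
  rewrite (exchange_big_dep predT) //= -sumrN; apply: eq_bigr => i _.
  rewrite (bigID (fun j : 'I_n => j == i)) /= big1 ?add0r; last first.
    move=> j /andP[_ /eqP ->].
    by rewrite mulrC subrr scale0r.
  rewrite -sumrN; apply: eq_big => [j|j _];
    first by rewrite -leqNgt ltn_neqAle eq_sym andbC.
  by rewrite -scaleNr opprB; congr (_ *: _); rewrite mulrC [in RHS]mulrC; ring.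
rewrite addrC -sumrB; apply: eq_bigr => i _; rewrite -sumrB;
  apply: eq_bigr => j _.
by rewrite -scalerBr.
Qed.

(** Row vectors [a] become polynomials of degree less than [n] through
    [a |-> a *m moment x]; the operators of the theorem act on these. *)
Definition moment x : 'M[F]_n := rep_col (fun i => x ^+ (n.-1 - i)).

(** Multiplying by [\prod_(c <- s) ('X - c)] removes the exceptions; then the
    characteristic 0 supplies more roots than the degree allows. *)
Lemma poly_eq0_cofinite (s : seq F) (p : {poly F}) :
  (forall x, x \notin s -> p.[x] = 0) -> p = 0.
Proof.
move=> p0; pose q := p * \prod_(c <- s) ('X - c%:P).
have q0 x : root q x.
  rewrite rootM root_prod_XsubC; have [//|/p0 px] := boolP (x \in s).
    by rewrite orbT.
  by rewrite /root px eqxx.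
suff /eqP : q = 0.
  rewrite mulf_eq0 => /orP[/eqP //|/eqP/polyP/(_ (size s))/eqP].
  have := monic_prod_XsubC s xpredT id; rewrite monicE /lead_coef.
  rewrite size_prod_XsubC /= => /eqP ->; rewrite coef0.
  by rewrite oner_eq0.
apply/eqP; apply: contraT => nzq;
  pose r := [seq i%:R : F | i <- iota 0 (size q)].
have ur : uniq r.
  by rewrite map_inj_uniq ?iota_uniq // => i j /eqP; rewrite eqr_nat => /eqP.
have := max_poly_roots nzq _ ur; rewrite size_map size_iota ltnn; apply.
by apply/allP => x _; apply: q0.
Qed.

(** Every entry of [L (moment x)] is a polynomial in [x] whose coefficients are
    the entries of the [L (basis_col i)]; it has infinitely many roots. *)
Lemma moment_ext p q (s : seq F) (L : 'M[F]_n -> 'M[F]_(p, q)) :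
  linear L -> (forall x, x \notin s -> L (moment x) = 0) ->
  forall i, L (basis_col i) = 0.
Proof.
move=> linL L0 i; apply/matrixP => k l; rewrite [RHS]mxE.
have L_0 : L 0 = 0 by have := linL (-1) 0 0;
  rewrite scaler0 addr0 scaleN1r addNr.
have LZ a A : L (a *: A) = a *: L A by have := linL a A 0; rewrite L_0 !addr0.
have LD A B : L (A + B) = L A + L B by have := linL 1 A B; rewrite !scale1r.
pose P := \sum_(j < n) L (basis_col j) k l *: 'X^(n.-1 - j).
have P0 : P = 0.
  apply: (@poly_eq0_cofinite s) => x /L0 /matrixP/(_ k l);
    rewrite [RHS]mxE => <-.
  rewrite /moment rep_col_sum (big_morph L LD L_0) summxE horner_sum;
    apply: eq_bigr => j _.
  by rewrite LZ mxE hornerZ hornerXn mulrC.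
have /polyP/(_ (n.-1 - i)%N) := P0; rewrite coef0 coef_sum (bigD1 i) //= big1.
  by rewrite coefZ coefXn eqxx mulr1 addr0.
move=> j ji; rewrite coefZ coefXn; case: eqP => [ij|]; last by rewrite mulr0.
case/eqP: ji; apply: val_inj => /=.
have le (k' : 'I_n) : (k' <= n.-1)%N by rewrite -ltnS (ltn_predK (ltn_ord k')).
by rewrite -(subKn (le j)) -ij subKn.
Qed.

Lemma basis_col_ext2 p (M : 'M[F]_(p, n * n)) :
  (forall i j, M *m (basis_col i *t basis_col j) = 0) -> M = 0.
Proof.
move=> M0; apply/matrixP => k l; case: (mxtens_indexP l) => i j.
have /matrixP/(_ k (mxtens_index (i, j))) := M0 i j; rewrite !mxE => <-.
rewrite (bigD1 (mxtens_index (i, j))) //= big1 ?addr0 => [|l'].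
  by rewrite tensmxE !mxE !eqxx !mulr1.
case: (mxtens_indexP l') => i' j';
  rewrite (inj_eq (can_inj (@mxtens_indexK _ _))).
by rewrite tensmxE !mxE xpair_eqE -natrM mulnb => /negPf ->; rewrite mulr0.
Qed.

Lemma basis_col_ext3 p (M : 'M[F]_(p, n * (n * n))) :
  (forall i j k, M *m (basis_col i *t (basis_col j *t basis_col k)) = 0) ->
  M = 0.
Proof.
move=> M0; apply/matrixP => r l; case: (mxtens_indexP l) => i jk.
case: (mxtens_indexP jk) => j k.
have /matrixP/(_ r (mxtens_index (i, mxtens_index (j, k)))) := M0 i j k.
rewrite !mxE => <-; rewrite (bigD1 (mxtens_index (i, mxtens_index (j, k)))) //=.
rewrite big1 ?addr0 => [|l'].
  by rewrite !tensmxE !mxE !eqxx !mulr1.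
case: (mxtens_indexP l') => i' jk'; case: (mxtens_indexP jk') => j' k'.
rewrite !(inj_eq (can_inj (@mxtens_indexK _ _))) xpair_eqE.
rewrite (inj_eq (can_inj (@mxtens_indexK _ _))) xpair_eqE !tensmxE !mxE.
by rewrite -!natrM !mulnb => /negPf ->; rewrite mulr0.
Qed.

(** Formulas with the denominator [x - y] only hold off the diagonal, but that
    is enough to determine a matrix: vary one parameter at a time, each
    avoiding the finitely many values already chosen. *)
Lemma moment2_eq0 p (M : 'M[F]_(p, n * n)) :
  (forall x y, x != y -> M *m (moment x *t moment y) = 0) -> M = 0.
Proof.
move=> M0; apply: basis_col_ext2 => i j.
apply: (@moment_ext _ _ [::] (fun A => M *m (A *t basis_col j))) => [a A B|x _].
  by rewrite tensmxDl mulmxDr tensmxZl scalemxAr.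
apply: (@moment_ext _ _ [:: x] (fun A => M *m (moment x *t A))) => [a A B|y].
  by rewrite tensmxDr mulmxDr tensmxZr scalemxAr.
by rewrite inE eq_sym => /M0.
Qed.

Lemma moment3_eq0 p (M : 'M[F]_(p, n * (n * n))) :
  (forall x y z, uniq [:: x; y; z] ->
     M *m (moment x *t (moment y *t moment z)) = 0) ->
  M = 0.
Proof.
move=> M0; apply: basis_col_ext3 => i j k.
apply: (@moment_ext _ _ [::]
  (fun A => M *m (A *t (basis_col j *t basis_col k)))) => [a A B|x _].
  by rewrite tensmxDl mulmxDr tensmxZl scalemxAr.
apply: (@moment_ext _ _ [:: x]
  (fun A => M *m (moment x *t (A *t basis_col k)))) => [a A B|y yx].
  by rewrite tensmxDl tensmxDr mulmxDr tensmxZl tensmxZr scalemxAr.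
apply: (@moment_ext _ _ [:: x; y]
  (fun A => M *m (moment x *t (moment y *t A)))) => [a A B|z zxy].
  by rewrite !tensmxDr mulmxDr !tensmxZr scalemxAr.
apply: M0; move: yx zxy; rewrite /= !inE !negb_or andbT => yx /andP[zx zy].
by rewrite (eq_sym x) yx (eq_sym x) zx (eq_sym y) zy.
Qed.

Definition dmoment x : 'M[F]_n :=
  rep_col (fun i => (n.-1 - i)%:R * x ^+ (n.-1 - i).-1).

(** Differentiation [d/dx] on polynomials of degree less than [n], written as
    a nilpotent matrix. *)
Definition deriv_mx : 'M[F]_n :=
  \sum_(0 <= j < n.-1) (n.-1 - j)%:R *: e_ j.+1 j.

Lemma deriv_mx_moment x : deriv_mx *m moment x = dmoment x.
Proof.
have stepV (j : 'I_n) : (j < n.-1)%N ->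
    e_ j.+1 j *m moment x = x ^+ (n.-1 - j).-1 *: basis_col j.
  by rewrite ltn_predRL => jn; rewrite (mul_e_rep_col (Ordinal jn)) /= subnS.
rewrite /dmoment rep_col_sum /deriv_mx mulmx_suml.
rewrite (big_nat_widen _ _ _ _ _ (leq_pred n)) big_mkord big_mkcond /=.
apply: eq_bigr => j _; case: ltnP => [jn|nj].
  by rewrite -scalemxAl stepV // scalerA.
by rewrite (eqP (nj : n.-1 - j == 0)%N) mul0r scale0r.
Qed.

(** The exchange of the two tensor factors. *)
Definition flip : 'M[F]_(n * n) := \sum_(i < n) \sum_(j < n) e_ j i *t e_ i j.

Lemma flip_rep_col f g :
  flip *m (rep_col f *t rep_col g) = rep_col g *t rep_col f.
Proof.
rewrite [RHS]rep_col_tens mulmx_suml; apply: eq_bigr => i _.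
rewrite mulmx_suml; apply: eq_bigr => j _.
by rewrite tensmx_mul !mul_e_rep_col tensmxZl tensmxZr scalerA mulrC.
Qed.

(** The derivative at [h = 0] of a polynomial identity in [h]; this is how
    invariance under translations becomes invariance under [d/dx]. *)
Lemma moment_translate p (M : 'M[F]_(p, n * n)) x y :
  (forall h, M *m (moment (x + h) *t moment (y + h)) = 0) ->
  M *m (dmoment x *t moment y + moment x *t dmoment y) = 0.
Proof.
move=> M0; apply/matrixP => k l; rewrite [RHS]mxE.
pose P := \sum_(i < n) \sum_(j < n) M k (mxtens_index (i, j)) *:
  (('X + x%:P) ^+ (n.-1 - i) * ('X + y%:P) ^+ (n.-1 - j)).
have sumE (G : 'I_(n * n) -> F) :
    \sum_s G s = \sum_i \sum_j G (mxtens_index (i, j)).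
  rewrite pair_big /= (reindex (@mxtens_index n n)) //=; last first.
    exists (@mxtens_unindex n n) => s _;
      [exact: mxtens_indexK | exact: mxtens_unindexK].
  by apply: eq_bigr => -[].
have P0 : P = 0.
  apply: (@poly_eq0_cofinite [::]) => h _.
  have /matrixP/(_ k l) := M0 h; rewrite !mxE sumE => <-.
  rewrite horner_sum; apply: eq_bigr => i _; rewrite horner_sum;
    apply: eq_bigr => j _.
  case: (mxtens_indexP l) => l1 l2; rewrite tensmxE !mxE.
  by rewrite !hornerE [h + x]addrC [h + y]addrC.
have := congr1 (fun p : {poly F} => p^`().[0]) P0; rewrite deriv0 horner0 => <-.
rewrite /P (big_morph _ (@derivD F) (@deriv0 F)) horner_sum mxE sumE;
  apply: eq_bigr => i _.
rewrite (big_morph _ (@derivD F) (@deriv0 F)) horner_sum; apply: eq_bigr => j _.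
case: (mxtens_indexP l) => l1 l2; rewrite [X in _ * X]mxE !tensmxE !mxE.
rewrite derivZ derivM !deriv_exp !derivD !derivC !derivX !addr0 !mul1r.
by rewrite !(hornerE, hornerMn) /= mulr_natl -mulrA mulr_natl.
Qed.
End Columns.

(** * The Cremmer-Gervais operator as a divided difference *)

Lemma sum_pow_mixed (R : comPzRingType) (x y : R) a b : (b <= a)%N ->
  (x - y) * (\sum_(k < a - b) x ^+ (a - k.+1) * y ^+ (b + k)) =
  x ^+ a * y ^+ b - x ^+ b * y ^+ a.
Proof.
move=> ba; have E (u : R) : u ^+ a = u ^+ b * u ^+ (a - b).
  by rewrite -exprD subnKC.
rewrite !E.
transitivity ((x ^+ b * y ^+ b) * (x ^+ (a - b) - y ^+ (a - b))); last by ring.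
rewrite subrXX mulrCA; congr (_ * _); rewrite big_distrr;
  apply: eq_bigr => k _ /=.
have -> : (a - k.+1 = b + ((a - b).-1 - k))%N by have := ltn_ord k; lia.
by rewrite !exprD; ring.
Qed.

Section Ops.
Variables (F : numFieldType) (n : nat).
Implicit Types (f g : 'I_n -> F) (x y z : F).
Local Notation moment := (@moment F n).

Lemma sum_lt_ord (V : nmodType) (G : nat -> nat -> V) :
  \sum_(0 <= i < n) \sum_(i.+1 <= j < n) G i j =
  \sum_(i < n) \sum_(j < n | (i < j)%N) G i j.
Proof.
rewrite big_mkord; apply: eq_bigr => i _.
by rewrite (big_nat_widenl _ 0) // big_mkord.
Qed.

(** The second sum of [b_CG] is by itself a solution with values in [gl(n)];
    [b_CG] is its projection to [sl(n)]. *)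
Definition T_CG : 'M[F]_(n * n) :=
  \sum_(0 <= i < n) \sum_(i.+1 <= j < n) \sum_(1 <= k < (j - i).+1)
     wedge (e_ (i + k) i) (e_ (j - k + 1) j).

(** On bivariate polynomials [T_CG] is the divided difference
    [G |-> (G (x, y) - G (y, x)) / (x - y)]: the inner sum over [k] is the
    geometric sum that divides [x^a y^b - x^b y^a] by [x - y]. *)
Lemma T_CG_moment x y : x != y -> T_CG *m (moment x *t moment y) =
  (x - y)^-1 *: (moment x *t moment y - moment y *t moment x).
Proof.
move=> xy; rewrite rep_col_wedge scaler_sumr /T_CG sum_lt_ord.
rewrite mulmx_suml; apply: eq_bigr => i _.
rewrite scaler_sumr mulmx_suml; apply: eq_bigr => j ij.
set a := (n.-1 - i)%N; set b := (n.-1 - j)%N.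
have ba : (b <= a)%N by rewrite leq_sub2l // ltnW.
have abE : (a - b = j - i)%N by have := ltn_ord j; rewrite /a /b; lia.
pose h x y : F := \sum_(k < a - b) x ^+ (a - k.+1) * y ^+ (b + k).
have hE u v : (u - v) * h u v = u ^+ a * v ^+ b - u ^+ b * v ^+ a.
  exact: sum_pow_mixed.
(* both sides of the wedge carry the same coefficient, since the geometric sum
   is symmetric in its two variables *)
have hC : h x y = h y x.
  apply: (mulfI (_ : x - y != 0)); first by rewrite subr_eq0.
  by rewrite hE -[x - y]opprB mulNr hE; ring.
rewrite -hE scalerA mulKf ?subr_eq0 // mulmx_suml.
rewrite /wedge scalerBr {2}hC /h !scaler_suml -sumrB abE big_add1 big_mkord.
apply: eq_bigr => k _; rewrite -/(wedge _ _) mul_wedge.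
have kij := ltn_ord k; have jn := ltn_ord j.
have pn : (i + k.+1 < n)%N by lia.
have qn : (j - k.+1 + 1 < n)%N by lia.
rewrite !(mul_e_rep_col (Ordinal pn)) !(mul_e_rep_col (Ordinal qn)) /=.
rewrite !(tensmxZl, tensmxZr) !scalerA.
have -> : (n.-1 - (i + k.+1) = a - k.+1)%N by rewrite /a; lia.
have -> : (n.-1 - (j - k.+1 + 1) = b + k)%N by rewrite /b; lia.
by rewrite [in X in _ - X *: _]mulrC.
Qed.

(** The divided difference commutes with simultaneous translations of [x] and
    [y], hence with [d/dx + d/dy]. *)
Lemma T_CG_translation_invariant :
  lie_br T_CG (deriv_mx F n *t 1%:M + 1%:M *t deriv_mx F n) = 0.
Proof.
apply: moment2_eq0 => x y xy; rewrite /lie_br mulmxBl -!mulmxA T_CG_moment //.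
rewrite -scalemxAr mulmxBr !mulmxDl !tensmx_mul !mul1mx !deriv_mx_moment.
(* this matrix depends on x and y through x - y only, and it annihilates
   moment x *t moment y by the divided difference formula *)
have := @moment_translate F n _ ((x - y) *: T_CG - 1%:M + flip F n) x y.
rewrite mulmxDl mulmxBl mul1mx !mulmxDr !flip_rep_col -!scalemxAl => E.
apply/eqP; rewrite subr_eq0; apply/eqP.
apply: (scalerI (_ : x - y != 0)); first by rewrite subr_eq0.
rewrite scalerA mulfV ?subr_eq0 // scale1r; apply/eqP; rewrite -subr_eq0.
rewrite -[X in _ == X]E ?mulmxDr => [|h].
  by apply/eqP/matrixP => i j; rewrite !mxE; ring.
have xhyh : x + h != y + h by rewrite (inj_eq (addIr h)).
rewrite mulmxDl mulmxBl mul1mx flip_rep_col -scalemxAl T_CG_moment // scalerA.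
have -> : x + h - (y + h) = x - y by ring.
by rewrite mulfV ?subr_eq0 // scale1r addrAC subrK subrr.
Qed.

(** Divided differences permute the three variables and divide by their
    differences; with [x], [y], [z] distinct the equation is an identity of
    rational functions times the six permutations of [x], [y], [z]. *)
Lemma CYBE_T_CG : CYBE T_CG.
Proof.
apply: moment3_eq0 => x y z;
  rewrite /= !inE negb_or andbT => /andP[/andP[xy xz] yz].
have T12 u v w : u != v -> leg12 T_CG *m (moment u *t (moment v *t moment w)) =
   (u - v)^-1 *: (moment u *t (moment v *t moment w)
                  - moment v *t (moment u *t moment w)).
  move=> uv.
  have split12 (A B C : 'M[F]_n) :
      A *t (B *t C) = leg12 (A *t B) *m (1%:M *t (1%:M *t C)).
    by rewrite leg12_tens !tensmx_mul !mulmx1 mul1mx.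
  rewrite (split12 (moment u) (moment v)) (split12 (moment v) (moment u))
    mulmxA -leg12M T_CG_moment // -mulmxBl scalemxAl; congr (_ *m _).
  by rewrite /leg12 tens_liftZ /wedge -scaleN1r tens_liftD tens_liftZ !scaleN1r.
have T13 u v w : u != w -> leg13 T_CG *m (moment u *t (moment v *t moment w)) =
   (u - w)^-1 *: (moment u *t (moment v *t moment w)
                  - moment w *t (moment v *t moment u)).
  move=> uv.
  have split13 (A B C : 'M[F]_n) :
      A *t (B *t C) = leg13 (A *t C) *m (1%:M *t (B *t 1%:M)).
    by rewrite leg13_tens !tensmx_mul !mulmx1 mul1mx.
  rewrite (split13 (moment u) (moment v)) (split13 (moment w) (moment v))
    mulmxA -leg13M T_CG_moment // -mulmxBl scalemxAl; congr (_ *m _).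
  by rewrite /leg13 tens_liftZ /wedge -scaleN1r tens_liftD tens_liftZ !scaleN1r.
have T23 u v w : v != w -> leg23 T_CG *m (moment u *t (moment v *t moment w)) =
   (v - w)^-1 *: (moment u *t (moment v *t moment w)
                  - moment u *t (moment w *t moment v)).
  move=> uv.
  have split23 (A B C : 'M[F]_n) :
      A *t (B *t C) = leg23 (B *t C) *m (A *t (1%:M *t 1%:M)).
    by rewrite leg23_tens !tensmx_mul !mulmx1 mul1mx.
  rewrite (split23 (moment u) (moment v)) (split23 (moment u) (moment w))
    mulmxA -leg23M T_CG_moment // -mulmxBl scalemxAl; congr (_ *m _).
  by rewrite /leg23 tens_liftZ /wedge -scaleN1r tens_liftD tens_liftZ !scaleN1r.
have dE u v : u != v -> u - v != 0 by rewrite subr_eq0.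
have [yx zx zy] : [/\ y != x, z != x & z != y] by split; rewrite eq_sym.
rewrite /lie_br !mulmxDl !mulNmx -!mulmxA !(T12, T13, T23) //.
rewrite -!scalemxAr !mulmxDr !mulmxN !(T12, T13, T23) //.
repeat match goal with |- context [?A *t (?B *t ?C)] =>
  move: (A *t (B *t C)) => ? end.
apply/matrixP => i j; rewrite !mxE; field.
by rewrite ?dE.
Qed.
End Ops.

(** * Projection to traceless tensors *)

Section SL.
Variables (F : numFieldType) (n : nat).
Hypothesis n_gt0 : (0 < n)%N.
Implicit Types (A B : 'M[F]_n).

Let nz_n : n%:R != 0 :> F.
Proof. by rewrite pnatr_eq0 -lt0n. Qed.

Lemma sum_e_diag : \sum_(0 <= i < n) e_ i i = 1%:M :> 'M[F]_n.
Proof.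
apply/matrixP => i j; rewrite summxE big_mkord (bigD1 i) //= big1 => [|k ki].
  by rewrite !mxE eqxx addr0 /= eq_sym.
by rewrite mxE eq_sym (negPf (ki : k != i :> nat)).
Qed.

Lemma mxtrace_e p q : (p < n)%N -> \tr (e_ p q : 'M[F]_n) = (p == q)%:R.
Proof.
move=> pn; rewrite /mxtrace (bigD1 (Ordinal pn)) //= big1 => [|k kp].
  by rewrite mxE eqxx andbT addr0.
by rewrite mxE (negPf (kp : k != p :> nat)) andbF.
Qed.

(** The coefficients [1 - j/n] of the first sum are those of [d/dx], divided
    by [n]. *)
Lemma b_CGE : b_CG F n = T_CG F n + n%:R^-1 *: wedge 1%:M (deriv_mx F n).
Proof.
rewrite /b_CG -/(T_CG F n) addrC; congr (_ + _).
rewrite -wedgeZr -sum_e_diag wedge_suml; apply: eq_bigr => i _.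
rewrite /deriv_mx scaler_sumr wedge_sumr !big_mkord; apply: eq_bigr => j _.
rewrite wedgeZr wedgeZr scalerA; congr (_ *: _).
have -> : (n.-1 - j = n - j.+1)%N by lia.
rewrite natrB; last by have := ltn_ord j; lia.
by field.
Qed.

Lemma CYBE_b_CG : CYBE (b_CG F n).
Proof.
rewrite b_CGE; apply: CYBE_add_wedge1; first exact: CYBE_T_CG.
exact: T_CG_translation_invariant.
Qed.

Definition sl_part A : 'M[F]_n := A - (\tr A / n%:R) *: 1%:M.

Lemma tr_sl_part A : \tr (sl_part A) = 0.
Proof. by rewrite /sl_part linearB linearZ /= mxtrace1 divfK // subrr. Qed.

Lemma sl_wedge_sl0 : sl_wedge_sl (0 : 'M[F]_(n * n)).
Proof. by exists [::]; rewrite big_nil. Qed.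

Lemma sl_wedge_slD (s t : 'M[F]_(n * n)) :
  sl_wedge_sl s -> sl_wedge_sl t -> sl_wedge_sl (s + t).
Proof.
by move=> [r [r0 ->]] [r' [r'0 ->]]; exists (r ++ r');
  rewrite all_cat r0 r'0 big_cat.
Qed.

Lemma sl_wedge_sl_sum I (r : seq I) (P : pred I) (f : I -> 'M[F]_(n * n)) :
  (forall i, P i -> sl_wedge_sl (f i)) -> sl_wedge_sl (\sum_(i <- r | P i) f i).
Proof.
move=> Pf; elim/big_ind: _ => //; [exact: sl_wedge_sl0 | exact: sl_wedge_slD].
Qed.

Lemma sl_wedge_sl_wedge a A B :
  \tr A = 0 -> \tr B = 0 -> sl_wedge_sl (a *: wedge A B).
Proof.
move=> A0 B0; exists [:: (a *: A, B)].
by rewrite /= linearZ /= A0 B0 mulr0 eqxx big_seq1 wedgeZl.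
Qed.

(** The factor [e_ (j - k + 1) j] has a trace only for [k = 1]. Subtracting its
    trace part there changes [T_CG] by [1 /\ d/dx] divided by [n], since
    [e_ i.+1 i] is counted once for each [j > i]. *)
Lemma b_CG_sl : b_CG F n = \sum_(0 <= i < n) \sum_(i.+1 <= j < n)
  \sum_(1 <= k < (j - i).+1) wedge (e_ (i + k) i) (sl_part (e_ (j - k + 1) j)).
Proof.
have deriv_mxE :
    deriv_mx F n = \sum_(0 <= i < n) \sum_(i.+1 <= j < n) e_ i.+1 i.
  under [RHS]eq_bigr => i _ do rewrite sumr_const_nat.
  have recr (V : nmodType) (G : nat -> V) :
      \sum_(0 <= i < n) G i = \sum_(0 <= i < n.-1) G i + G n.-1.
    by rewrite -[in LHS](prednK n_gt0) big_nat_recr.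
  rewrite recr prednK // subnn addr0.
  by apply: eq_bigr => i _; rewrite -scaler_nat; congr (_%:R *: _); lia.
rewrite b_CGE wedgeNC scalerN deriv_mxE wedge_suml scaler_sumr -sumrB.
rewrite [LHS]big_nat [RHS]big_nat; apply: eq_bigr => i /andP[_ ltin].
rewrite wedge_suml scaler_sumr -sumrB.
rewrite [LHS]big_nat [RHS]big_nat; apply: eq_bigr => j /andP[ij jn].
have ji : (0 < j - i)%N by rewrite subn_gt0.
rewrite !(big_ltn (ji : (1 < (j - i).+1)%N)) addrAC; congr (_ + _).
  rewrite subnK ?(leq_trans _ ij) // /sl_part mxtrace_e // eqxx mul1r addn1.
  by rewrite -[- (_ *: 1%:M)]scaleNr wedgeDr wedgeZr scaleNr.
rewrite big_nat [RHS]big_nat; apply: eq_bigr => k /andP[k1 kji].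
rewrite /sl_part mxtrace_e; last by lia.
rewrite (_ : (_ == j) = false) ?mul0r ?scale0r ?subr0 //; lia.
Qed.

Lemma sl_wedge_sl_b_CG : sl_wedge_sl (b_CG F n).
Proof.
rewrite b_CG_sl big_nat; apply: sl_wedge_sl_sum => i /andP[_ ltin].
rewrite big_nat; apply: sl_wedge_sl_sum => j /andP[ij jn].
rewrite big_nat; apply: sl_wedge_sl_sum => k /andP[k1 kji].
rewrite -[wedge _ _]scale1r; apply: sl_wedge_sl_wedge; last exact: tr_sl_part.
rewrite mxtrace_e; last by lia.
by rewrite (_ : (_ == i) = false) //; lia.
Qed.

Lemma sl_wedge_sl_r_tilde (mu : 'I_n -> F) : sl_wedge_sl (r_tilde mu).
Proof.
have trZ (i j : 'I_n) : i != j -> \tr (Ztilde i j : 'M[F]_n) = 0.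
  move=> ij; rewrite /Ztilde sum_e_diag linearD linearZ linearB /= mxtrace1.
  by rewrite !mxtrace_e // eqxx (negPf (ij : i != j :> nat)) mulVf // sub0r
    addNr.
apply: sl_wedge_sl_sum => i _; apply: sl_wedge_sl_sum => j ij.
have neq : i != j by rewrite -val_eqE ltn_eqF.
by apply: sl_wedge_sl_wedge; apply: trZ; rewrite // eq_sym.
Qed.

End SL.

(** * The change of basis and the Lagrange polynomials *)

Lemma prod_XaddC_mesym (R : comNzRingType) m (a : 'I_m -> R) :
  \prod_(i < m) ('X + (a i)%:P) =
  \sum_(k < m.+1) mpoly.meval a (mpoly.mesym m R k) *: 'X^(m - k).
Proof.
under eq_bigr do rewrite addrC.
rewrite bigA_distr /=.
rewrite (partition_big (fun J : {set 'I_m} => inord #|J| : 'I_m.+1) predT) //=.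
apply: eq_bigr => k _; rewrite /mpoly.mesym.
rewrite (big_morph _ (mpoly.mevalD a) (mpoly.meval0 a)) scaler_suml.
apply: eq_big => [J|J /eqP Jk].
  by rewrite -val_eqE /= inordK // ltnS -[m in (_ <= m)%N]card_ord max_card.
have {}Jk : #|J| = k.
  by rewrite -Jk inordK // ltnS -[m in (_ <= m)%N]card_ord max_card.
rewrite (big_morph _ (mpoly.mevalM a) (mpoly.meval1 a)) (bigID (mem J)) /=.
under eq_bigr => i -> do [].
under [X in _ * X]eq_bigr => i /negPf -> do [].
rewrite -mul_polyC rmorph_prod /=; congr (_ * _).
  by apply: eq_bigr => i _; rewrite mpoly.mevalXU.
rewrite prodr_const; congr (_ ^+ _).
apply: (@addnI k); rewrite subnKC -1?ltnS // -[RHS]card_ord -(cardC J) Jk.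
by congr addn; apply: eq_card.
Qed.

Lemma deriv_prod (R : comNzRingType) (I : eqType) (r : seq I) (P : pred I)
    (f : I -> {poly R}) :
  uniq r ->
  (\prod_(i <- r | P i) f i)^`() =
  \sum_(i <- r | P i) (f i)^`() * \prod_(k <- r | P k && (k != i)) f k.
Proof.
elim: r => [|a r IH /= /andP[ar ur]]; first by rewrite !big_nil derivC.
have others i : i \in r -> a != i by move=> ir; apply: contraNneq ar => ->.
have Ea : \prod_(k <- r | P k && (k != a)) f k = \prod_(k <- r | P k) f k.
  rewrite big_seq_cond [RHS]big_seq_cond; apply: eq_bigl => k.
  by case: (boolP (k \in r)) => //= /others; rewrite eq_sym => ->;
    rewrite andbT.
have tailE :
    \sum_(i <- r | P i)
       (f i)^`() * \prod_(k <- a :: r | P k && (k != i)) f k =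
    (if P a then f a else 1) *
    \sum_(i <- r | P i) (f i)^`() * \prod_(k <- r | P k && (k != i)) f k.
  rewrite big_distrr /= big_seq_cond [RHS]big_seq_cond;
    apply: eq_bigr => i /andP[ir _].
  by rewrite big_cons others // andbT; case: (P a); rewrite ?mul1r // mulrCA.
rewrite !big_cons eqxx andbF Ea tailE; case: (P a); rewrite ?mul1r ?IH //.
by rewrite derivM IH.
Qed.

Section Lagrange.
Variables (F : numFieldType) (n : nat) (mu : 'I_n -> F).
Implicit Types (x y : F).
Local Notation moment := (@moment F n).
Local Notation X := (X_mu mu).

(** These polynomials are the Lagrange basis for the nodes [- mu i], up to
    normalisation; the rows of [X_mu] hold their coefficients. *)
Definition lagr (j : 'I_n) : {poly F} :=
  \prod_(i < n | i != j) ('X + (mu i)%:P).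

Lemma lagrE j : lagr j = \sum_(k < n) X j k *: 'X^(n.-1 - k).
Proof.
have n0 : (0 < n)%N := leq_ltn_trans (leq0n j) (ltn_ord j).
pose G (k : nat) :=
  mpoly.meval (fun i : 'I_n.-1 => mu (lift j i)) (mpoly.mesym n.-1 F k)
    *: 'X^(n.-1 - k).
transitivity (\sum_(k < n) G k); last by apply: eq_bigr => k _; rewrite mxE.
rewrite -(big_mkord xpredT G) -(prednK n0) big_mkord.
rewrite -(prod_XaddC_mesym (fun i : 'I_n.-1 => mu (lift j i))) /lagr.
rewrite (reindex_omap (lift j) (unlift j)) => [|i ij].
  by apply: eq_bigl => i; rewrite liftK eqxx andbT eq_sym neq_lift.
by case: unliftP ij => [k ->|->]; rewrite ?eqxx.
Qed.

Lemma mul_X_moment x : X *m moment x = rep_col (fun j => (lagr j).[x]).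
Proof.
apply/matrixP => j l; rewrite !mxE lagrE horner_sum; apply: eq_bigr => k _.
by rewrite !mxE hornerZ hornerXn.
Qed.

Lemma mul_X_dmoment x : X *m dmoment n x = rep_col (fun j => (lagr j)^`().[x]).
Proof.
apply/matrixP => j l; rewrite !mxE lagrE (big_morph _ (@derivD F) (@deriv0 F)).
rewrite horner_sum; apply: eq_bigr => k _.
by rewrite !mxE derivZ derivXn hornerZ hornerMn hornerXn mulr_natl.
Qed.

Definition lagr2 (i j : 'I_n) : {poly F} :=
  \prod_(k < n | (k != i) && (k != j)) ('X + (mu k)%:P).

Lemma lagr2C i j : lagr2 i j = lagr2 j i.
Proof. by apply: eq_bigl => k; rewrite andbC. Qed.

Lemma lagr_split i j : i != j -> lagr i = ('X + (mu j)%:P) * lagr2 i j.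
Proof. by move=> ij; rewrite /lagr (bigD1 j) //= eq_sym. Qed.

Lemma deriv_lagr i : (lagr i)^`() = \sum_(j < n | j != i) lagr2 i j.
Proof.
rewrite deriv_prod ?index_enum_uniq //; apply: eq_bigr => j _.
by rewrite derivD derivX derivC addr0 mul1r.
Qed.

(** [X_mu] times the Vandermonde matrix of the nodes [- mu l] is diagonal with
    nonzero entries, because [lagr j] vanishes at all nodes but its own. *)
Lemma X_mu_unit : injective mu -> X \in unitmx.
Proof.
move=> mu_inj; pose N : 'M[F]_n := \matrix_(k, l) (- mu l) ^+ (n.-1 - k).
pose c j := (lagr j).[- mu j].
have cE j l : (lagr j).[- mu l] = if l == j then c j else 0.
  case: eqP => [->//|/eqP lj]; rewrite (lagr_split (_ : j != l));
    last by rewrite eq_sym.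
  by rewrite hornerM !hornerE addNr mul0r.
have c0 j : c j != 0.
  rewrite /c horner_prod; apply/prodf_neq0 => i ij.
  by rewrite !hornerE addrC subr_eq0 (inj_eq mu_inj).
suff /mulmx1_unit[] : X *m (N *m diag_mx (\row_j (c j)^-1)) = 1%:M by [].
apply/matrixP => j l; rewrite mulmxA mul_mx_diag !mxE.
have -> : \sum_k X j k * N k l = (lagr j).[- mu l].
  by rewrite lagrE horner_sum; apply: eq_bigr => k _;
    rewrite hornerZ hornerXn [N k l]mxE.
by rewrite cE eq_sym; case: eqP => [->|_]; rewrite ?mulfV ?mul0r.
Qed.

Lemma mul_Ztilde_rep_col (f : 'I_n -> F) (i j : 'I_n) :
  Ztilde i j *m rep_col f = (f i - f j) *: basis_col F j + n%:R^-1 *: rep_col f.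
Proof.
have n0 : (0 < n)%N := leq_ltn_trans (leq0n j) (ltn_ord j).
rewrite /Ztilde sum_e_diag // mulmxDl mulmxBl !mul_e_rep_col scalerBl.
by rewrite -scalemxAl mul1mx.
Qed.

(** The derivative of a product of [n - 1] factors is the sum over the omitted
    factor; each [lagr2 i j] occurs in the derivatives of [lagr i] and
    [lagr j]. *)
Lemma sum_lagr2 x :
  \sum_(i < n) \sum_(j < n | (i < j)%N)
     (lagr2 i j).[x] *: (basis_col F i + basis_col F j) =
  rep_col (fun i => (lagr i)^`().[x]).
Proof.
under eq_bigr => i _ do under eq_bigr => j _ do rewrite scalerDr.
under eq_bigr do rewrite big_split /=.
rewrite big_split /= [X in _ + X](exchange_big_dep predT) //= -big_split /=.
rewrite rep_col_sum; apply: eq_bigr => i _.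
rewrite deriv_lagr horner_sum scaler_suml.
rewrite [RHS](bigID (fun j : 'I_n => (i < j)%N)) /=; congr (_ + _).
  by apply: eq_bigl => j; case: ltngtP => //; rewrite -val_eqE /=; case: ltngtP.
apply: eq_big => [j|j _]; last by rewrite lagr2C.
by rewrite -val_eqE /=; case: ltngtP.
Qed.

(** The term [(i, j)] of [r_tilde] contributes
    [lagr i - lagr j = (mu j - mu i) lagr2 i j], and [mu j - mu i] cancels
    against the denominator. What remains has the shape of [b_CG] on the
    moment curve: a divided difference and a derivative divided by [n]. *)
Lemma r_tilde_moment x y (W := X *m moment x) (W' := X *m moment y) :
  injective mu -> x != y ->
  r_tilde mu *m (W *t W') =
  (x - y)^-1 *: (W *t W' - W' *t W)
  + n%:R^-1 *: (W *t (X *m dmoment n y) - (X *m dmoment n x) *t W').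
Proof.
move=> mu_inj xy; rewrite /W /W' !mul_X_moment !mul_X_dmoment -!sum_lagr2.
set w := rep_col _; set w' := rep_col _; set c := n%:R^-1.
rewrite rep_col_wedge tensmx_sumr tensmx_suml -sumrB !scaler_sumr -big_split /=.
rewrite mulmx_suml; apply: eq_bigr => i _.
rewrite tensmx_sumr tensmx_suml -sumrB !scaler_sumr -big_split /= mulmx_suml.
apply: eq_bigr => j ij.
have neq : i != j by rewrite -val_eqE ltn_eqF.
have muij : mu i - mu j != 0 by rewrite subr_eq0 (inj_eq mu_inj).
have xy0 : x - y != 0 by rewrite subr_eq0.
rewrite -scalemxAl mul_wedge !mul_Ztilde_rep_col -/w -/w' -/c.
rewrite (lagr_split neq) (lagr_split (_ : j != i)) 1?eq_sym // (lagr2C j i).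
rewrite /wedge !(tensmxDl, tensmxDr) !(tensmxZl, tensmxZr).
rewrite !(tensmxDl, tensmxDr) !hornerE.
move: ((lagr2 i j).[x]) ((lagr2 i j).[y]) => p q.
move: (basis_col F i) (basis_col F j) => a b.
move: (w *t w') (w *t a) (w *t b) (a *t w') (b *t w') (a *t b) (b *t a).
move=> *; apply/matrixP => k l; rewrite !mxE /=; field.
by rewrite muij xy0.
Qed.

Lemma r_tilde_intertwine : (0 < n)%N -> injective mu ->
  r_tilde mu *m (X *t X) = (X *t X) *m b_CG F n.
Proof.
move=> n0 mu_inj; apply/eqP; rewrite -subr_eq0; apply/eqP;
  apply: moment2_eq0 => x y xy.
apply/eqP; rewrite mulmxBl subr_eq0 -!mulmxA tensmx_mul r_tilde_moment //.
rewrite (b_CGE F n0) mulmxDl T_CG_moment // -[(n%:R^-1 *: _) *m _]scalemxAl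
  mul_wedge.
rewrite !mul1mx !deriv_mx_moment mulmxDr -!scalemxAr !mulmxBr !tensmx_mul.
by rewrite eqxx.
Qed.

Lemma r_tilde_Ad : (0 < n)%N -> injective mu ->
  r_tilde mu = tens_map (Ad X) (Ad X) (b_CG F n).
Proof.
move=> n0 mu_inj; rewrite tens_map_Ad -r_tilde_intertwine // -mulmxA tensmx_mul.
by rewrite mulmxV ?X_mu_unit // tensmx11 mulmx1.
Qed.
End Lagrange.

Unset Implicit Arguments.

Theorem proposition8 (R : realType) (n : nat) (mu : 'I_n -> R[i])
    (hn : (2 <= n)%N) (hmu : injective mu) :
  [/\ X_mu mu \in unitmx,
      sl_wedge_sl (b_CG R[i] n) /\ CYBE (b_CG R[i] n),
      sl_wedge_sl (r_tilde mu) /\ CYBE (r_tilde mu)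
    & r_tilde mu = tens_map (Ad (X_mu mu)) (Ad (X_mu mu)) (b_CG R[i] n)].
Proof.
have n_gt0 : (0 < n)%N := ltnW hn.
have uX : X_mu mu \in unitmx := X_mu_unit hmu.
have rE := r_tilde_Ad n_gt0 hmu.
have cybe : CYBE (b_CG R[i] n) := CYBE_b_CG R[i] n_gt0.
split; [exact: uX | split | split | exact: rE].
- exact: sl_wedge_sl_b_CG.
- exact: cybe.
- exact: sl_wedge_sl_r_tilde.
- by rewrite rE; apply: CYBE_Ad.
Qed.
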